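(* Let $m=p+q$ with $p,q\ge1$, $n\ge1$, let $\mathfrak g=\mathfrak{sl}(m|n)$ and $\omega=\omega_{p,q|0,n}$. Let $L(\Lambda;\Delta^+_{\mathrm{st}})$ be an irreducible unitary highest weight representation and let $\varphi:L(\Lambda;\Delta^+_{\mathrm{st}})\to\Pi^{\epsilon}L(\Lambda';\Delta^+_{\mathrm{nst}})$ be a $\mathfrak g$-isomorphism which preserves the (suitably normalized) contravariant Hermitian forms. Then for every $v\in L(\Lambda;\Delta^+_{\mathrm{st}})$, $$\bigl\langle \mathrm D^2(\varphi(v)\otimes1_{\mathrm{nst}}),\varphi(v)\otimes1_{\mathrm{nst}}\bigr\rangle_{\Pi^{\epsilon}L(\Lambda';\Delta^+_{\mathrm{nst}})\otimes M(\mathfrak g_{\bar1})}=\bigl\langle(\mathrm D^2+\mathcal C)(v\otimes1_{\mathrm{st}}),v\otimes1_{\mathrm{st}}\bigr\rangle_{L(\Lambda;\Delta^+_{\mathrm{st}})\otimes M(\mathfrak g_{\bar1})},$$ where $\mathrm D$ is the relative Dirac operator for $(\mathfrak g,\mathfrak g_{\bar0})$ and $\mathcal C=4\sum_{i=pn+1}^{mn}[\partial_i^{\mathrm{st}},x_i^{\mathrm{st}}]\otimes1$.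
   Context: $\mathfrak{sl}(m|n)$ is the complex Lie superalgebra of block matrices of supertrace $0$ (for $m=n$ weight-theoretic statements are understood after passing to $\mathfrak{gl}(n|n)$); $\epsilon_i,\delta_a$ are the coordinate functions on diagonal matrices; $\Delta_{\bar0}^+=\{\epsilon_i-\epsilon_j:i<j\}\sqcup\{\delta_a-\delta_b:a<b\}$; $\Delta^+_{\mathrm{st}}=\Delta_{\bar0}^+\sqcup\{\epsilon_i-\delta_a\}_{1\le i\le m,1\le a\le n}$; $\Delta^+_{\mathrm{nst}}=\Delta_{\bar0}^+\sqcup\{\epsilon_i-\delta_a:i\le p\}\sqcup\{\delta_a-\epsilon_j:j>p\}$. $B(X,Y)=\frac12\mathrm{str}(XY)$. $\omega_{p,q|0,n}(X)=J^{-1}\overline X^{\,t}J$, $J=\mathrm{diag}(I_p,-I_q,-I_n)$. A representation is unitary if it carries a positive definite Hermitian form with even and odd part orthogonal and $\langle Xv,w\rangle=\langle v,\omega(X)w\rangle$. $L(\Lambda;\Delta^+)$ is the simple highest weight representation; $\Pi$ is parity reversal (same action of $\mathfrak g$, opposite grading). $\Lambda'$ is the unique weight with $L(\Lambda;\Delta^+_{\mathrm{st}})\cong\Pi^\epsilon L(\Lambda';\Delta^+_{\mathrm{nst}})$ for some $\epsilon\in\{0,1\}$; the contravariant ($\langle Xv,w\rangle=\langle v,\omega(X)w\rangle$) Hermitian form on each side is unique up to a nonzero real scalar, and the two are normalized so that $\varphi$ is an isometry. Polarized bases: for $1\le i\le m$, $1\le j\le n$, $\partial^{\mathrm{st}}_{(i-1)n+j}=E_{i,m+j}$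 and $x^{\mathrm{st}}_{(i-1)n+j}=E_{m+j,i}$ (matrix units). For $1\le k\le pn$: $\partial_k^{\mathrm{nst}}=\partial_k^{\mathrm{st}}$, $x_k^{\mathrm{nst}}=x_k^{\mathrm{st}}$; for $pn+1\le k\le mn$: $\partial_k^{\mathrm{nst}}=x_k^{\mathrm{st}}$, $x_k^{\mathrm{nst}}=-\partial_k^{\mathrm{st}}$. In each case $B(\partial_k,x_l)=\frac12\delta_{kl}$. For either polarization, the Weyl algebra $\mathscr W(\mathfrak g_{\bar1})$ is the algebra of polynomial differential operators in $x_1,\dots,x_{mn}$ with $\partial_k=\partial/\partial x_k$; the oscillator module is $M(\mathfrak g_{\bar1})=\mathbb C[x_1,\dots,x_{mn}]$ with vacuum vector $1$ (denoted $1_{\mathrm{st}}$, resp. $1_{\mathrm{nst}}$) and Hermitian form $\langle\prod x_k^{p_k},\prod x_k^{q_k}\rangle=\delta_{p,q}\prod p_k!$. The Dirac operator is $\mathrm D=2\sum_k(\partial_k\otimes x_k-x_k\otimes\partial_k)\in U(\mathfrak g)\otimes\mathscr W(\mathfrak g_{\bar1})$ (ordinary tensor product of algebras); it is independent of the choice of dual Lagrangian bases and acts on $M\otimes M(\mathfrak g_{\bar1})$ for every $\mathfrak g$-representation $M$ (using the oscillator module of the respective polarization). Tensor products carry the product Hermitian form $\langle v\otimes P,w\otimes Q\rangle=\langle v,w\rangle\langle P,Q\rangle$. *)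

(* Defs.v *)
From HB Require Import structures.
From mathcomp Require Import all_boot all_order all_algebra.
From mathcomp Require Import sesquilinear ring_quotient generic_quotient.
From mathcomp Require Import boolp reals complex.
From mathcomp Require Import ssrcomplements freeg mpoly.

Set Implicit Arguments.
Unset Strict Implicit.
Unset Printing Implicit Defensive.

Import Order.TTheory GRing.Theory Num.Theory.
Local Open Scope ring_scope.
Local Open Scope quotient_scope.

(** * Tensor product of two vector spaces

    The free module on [V * W] modulo the submodule spanned by the bilinearity
    relations. *)

Section Tensor.
Variables (F : fieldType) (V W : lmodType F).

Definition tfree := {freeg (V * W)%type / F}.

Definition tgen (v : V) (w : W) : tfree := << (v, w) >>.

Inductive tnull : tfree -> Prop :=
| tnull_addl v v' w : tnull (tgen (v + v') w - tgen v w - tgen v' w)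
| tnull_addr v w w' : tnull (tgen v (w + w') - tgen v w - tgen v w')
| tnull_scalel c v w : tnull (tgen (c *: v) w - c *: tgen v w)
| tnull_scaler c v w : tnull (tgen v (c *: w) - c *: tgen v w)
| tnull_0 : tnull 0
| tnull_lin c s t : tnull s -> tnull t -> tnull (c *: s + t).

Definition tnullb (s : tfree) : bool := `[< tnull s >].

Lemma tnullb_zmod_closed : zmod_closed tnullb.
Proof.
split=> [|s t /asboolP hs /asboolP ht]; apply/asboolP; first exact: tnull_0.
by rewrite addrC -scaleN1r; apply: tnull_lin.
Qed.

HB.instance Definition _ :=
  GRing.isZmodClosed.Build tfree tnullb tnullb_zmod_closed.

Definition tzmod : zmodClosed tfree := GRing.ZmodClosed.clone _ tnullb _.
Definition tens := Quotient.quot tzmod.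
HB.instance Definition _ := Choice.on tens.
HB.instance Definition _ := GRing.Zmodule.on tens.
HB.instance Definition _ := Quotient.on tens.

Definition tpi (s : tfree) : tens := \pi_tens s.

Lemma tpiB s t : tpi (s - t) = tpi s - tpi t.
Proof. by rewrite /tpi !piE. Qed.

Lemma tpi_is_zmod : zmod_morphism tpi. Proof. exact: tpiB. Qed.
HB.instance Definition _ := GRing.isZmodMorphism.Build _ _ tpi tpi_is_zmod.

Lemma tpi_eq s t : tpi s = tpi t <-> tnull (s - t).
Proof.
split=> [/eqP|h].
  by rewrite -Quotient.idealrBE => /asboolP.
by apply/eqP; rewrite -Quotient.idealrBE; apply/asboolP.
Qed.

Lemma tpiK (s : tens) : tpi (repr s) = s. Proof. exact: reprK. Qed.

Definition tscale (c : F) (s : tens) : tens := tpi (c *: repr s).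

Lemma tscale_pi c s : tscale c (tpi s) = tpi (c *: s).
Proof.
apply/tpi_eq; rewrite -scalerBr -[_ *: _]addr0; apply: tnull_lin.
  by apply/tpi_eq; rewrite tpiK.
exact: tnull_0.
Qed.

Lemma tscaleA a b s : tscale a (tscale b s) = tscale (a * b) s.
Proof. by rewrite -[s]tpiK !tscale_pi scalerA. Qed.
Lemma tscale1 : left_id 1 tscale.
Proof. by move=> s; rewrite -[s]tpiK tscale_pi scale1r. Qed.
Lemma tscaleDr : right_distributive tscale +%R.
Proof.
by move=> a s t; rewrite -[s]tpiK -[t]tpiK -raddfD !tscale_pi -raddfD scalerDr.
Qed.
Lemma tscaleDl s : {morph tscale^~ s : a b / a + b}.
Proof. by move=> a b; rewrite -[s]tpiK !tscale_pi -raddfD scalerDl. Qed.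

HB.instance Definition _ :=
  GRing.Zmodule_isLmodule.Build F tens tscaleA tscale1 tscaleDr tscaleDl.

Definition tpure (v : V) (w : W) : tens := tpi (tgen v w).

Lemma tpiZ c s : tpi (c *: s) = c *: tpi s.
Proof. by rewrite -tscale_pi. Qed.

Lemma tpure_addl v v' w : tpure (v + v') w = tpure v w + tpure v' w.
Proof. by rewrite -raddfD; apply/tpi_eq; rewrite opprD addrA; exact: tnull_addl. Qed.
Lemma tpure_addr v w w' : tpure v (w + w') = tpure v w + tpure v w'.
Proof. by rewrite -raddfD; apply/tpi_eq; rewrite opprD addrA; exact: tnull_addr. Qed.
Lemma tpure_scalel c v w : tpure (c *: v) w = c *: tpure v w.
Proof. by rewrite -tpiZ; apply/tpi_eq; exact: tnull_scalel. Qed.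
Lemma tpure_scaler c v w : tpure v (c *: w) = c *: tpure v w.
Proof. by rewrite -tpiZ; apply/tpi_eq; exact: tnull_scaler. Qed.

Lemma tpure_bilinear : bilinear_for *:%R *:%R tpure.
Proof.
split=> u c s t; first by rewrite tpure_addl tpure_scalel.
by rewrite tpure_addr tpure_scaler.
Qed.

Lemma tens_ind (P : tens -> Prop) :
  P 0 -> (forall v w s, P s -> P (tpure v w + s)) -> forall s, P s.
Proof.
move=> P0 PD s; rewrite -[s]tpiK -[repr s]freeg_sumE raddf_sum.
elim: (dom (repr s)) => [|[v w] r IHr]; first by rewrite big_nil.
rewrite big_cons -[coeff _ _]mulr1 /=.
have -> : << coeff (v, w) (repr s) * 1 *g (v, w) >>
          = coeff (v, w) (repr s) *: tgen v w.
  by apply/eqP/freeg_eqP=> k; rewrite coeffZ !coeffU mul1r mulr1.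
by rewrite tpiZ -[X in X + _]tpure_scalel; apply: PD.
Qed.

End Tensor.

Notation "v ⊗ w" := (tpure v w) (at level 40, left associativity).

(** The linear map induced by [b]; only meaningful for bilinear [b]. *)
Section Lift.
Variables (F : fieldType) (V W Z : lmodType F) (b : V -> W -> Z).

Definition tlift (s : tens V W) : Z := fglift (fun vw => b vw.1 vw.2) (repr s).

Local Notation bext := (fglift (fun vw => b vw.1 vw.2)).

Lemma bext_lin c (s t : tfree V W) : bext (c *: s + t) = c *: bext s + bext t.
Proof.
have addE : {morph bext : x y / x + y >-> x + y}.
  have hB := lift_is_additive (fun vw : V * W => b vw.1 vw.2).
  have h0 : bext 0 = 0 by rewrite -[0 in LHS](subrr 0) hB subrr.
  by move=> x y; rewrite -[y in LHS]opprK hB -[- y]sub0r hB h0 sub0r opprK.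
rewrite addE; congr (_ + _).
have sumE (I : Type) (r : seq I) (G : I -> tfree V W) :
    bext (\sum_(i <- r) G i) = \sum_(i <- r) bext (G i).
  elim: r => [|i r IHr]; last by rewrite !big_cons addE IHr.
  rewrite !big_nil -[0 in LHS](subrr 0).
  by rewrite (lift_is_additive (fun vw : V * W => b vw.1 vw.2)) subrr.
rewrite -[s]freeg_sumE scaler_sumr !sumE scaler_sumr.
apply: eq_bigr => k _; rewrite liftU scalerA.
have -> : c *: << coeff k s *g k >> = << c * coeff k s *g k >> :> tfree V W.
  by apply/eqP/freeg_eqP=> j; rewrite coeffZ !coeffU mulrA.
by rewrite liftU.
Qed.

Hypothesis b_bilinear : bilinear_for *:%R *:%R b.

Let bl v v' w c : b (c *: v + v') w = c *: b v w + b v' w.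
Proof. exact: (b_bilinear.1 w). Qed.
Let br v w w' c : b v (c *: w + w') = c *: b v w + b v w'.
Proof. exact: (b_bilinear.2 v). Qed.

Lemma bext_gen v w : bext (tgen v w) = b v w.
Proof. by rewrite /tgen liftU scale1r. Qed.

Lemma bext_null s : tnull s -> bext s = 0.
Proof.
have B (x y : tfree V W) : bext (x - y) = bext x - bext y.
  exact: (lift_is_additive (fun vw : V * W => b vw.1 vw.2)).
have Zc c (x : tfree V W) : bext (c *: x) = c *: bext x.
  have h0 : bext 0 = 0 by rewrite -[0 in LHS](subrr 0) B subrr.
  by have := bext_lin c x 0; rewrite addr0 h0 addr0.
have bl0 w : b 0 w = 0 by have := bl 0 0 w (-1); rewrite scaleN1r addNr scaleN1r addNr.
have br0 v : b v 0 = 0 by have := br v 0 0 (-1); rewrite scaleN1r addNr scaleN1r addNr.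
elim=> [v v' w|v w w'|c v w|c v w| |c s1 t _ hs _ ht]; rewrite ?B ?Zc ?bext_gen.
- by have := bl v v' w 1; rewrite !scale1r => ->; rewrite -addrA -opprD subrr.
- by have := br v w w' 1; rewrite !scale1r => ->; rewrite -addrA -opprD subrr.
- by have := bl v 0 w c; rewrite addr0 bl0 addr0 => ->; rewrite subrr.
- by have := br v w 0 c; rewrite addr0 br0 addr0 => ->; rewrite subrr.
- by rewrite -[0 in LHS](subrr 0) B subrr.
- by rewrite bext_lin hs ht scaler0 addr0.
Qed.

Lemma tlift_pi s : tlift (tpi s) = bext s.
Proof.
apply/eqP; rewrite -subr_eq0; apply/eqP.
rewrite /tlift -(lift_is_additive (fun vw : V * W => b vw.1 vw.2)).
by apply: bext_null; apply/tpi_eq; rewrite tpiK.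
Qed.

Lemma tlift_pure v w : tlift (v ⊗ w) = b v w.
Proof. by rewrite tlift_pi bext_gen. Qed.

Lemma tlift_linear : linear tlift.
Proof.
move=> c s t; rewrite -[s]tpiK -[t]tpiK -tpiZ -raddfD !tlift_pi.
exact: bext_lin.
Qed.

End Lift.

Definition tmap (F : fieldType) (V W V' W' : lmodType F)
    (f : V -> V') (g : W -> W') : tens V W -> tens V' W' :=
  tlift (fun v w => f v ⊗ g w).

Section TMap.
Variables (F : fieldType) (V W V' W' : lmodType F) (f : V -> V') (g : W -> W').
Hypotheses (hf : linear f) (hg : linear g).

Let fg_bilinear : bilinear_for *:%R *:%R (fun v w => f v ⊗ g w).
Proof.
split=> u c s t /=.
  by rewrite hf tpure_addl tpure_scalel.
by rewrite hg tpure_addr tpure_scaler.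
Qed.

Lemma tmap_pure v w : tmap f g (v ⊗ w) = f v ⊗ g w.
Proof. exact: tlift_pure. Qed.

Lemma tmap_linear : linear (tmap f g).
Proof. exact: tlift_linear. Qed.

End TMap.

(** The product of two sesquilinear forms; the forms are linear in the first
    argument, whence the two conjugations around the inner lift. *)
Definition tform (C : numClosedFieldType) (V W : lmodType C)
    (f : V -> V -> C) (g : W -> W -> C) (s t : tens V W) : C :=
  tlift (fun v w =>
    (tlift (fun v' w' => (f v v' * g w w')^* : C^o) t)^* : C^o) s.

Section TForm.
Variables (C : numClosedFieldType) (V W : lmodType C).
Variables (f : {hermitian V for false & Num.conj}).
Variables (g : {hermitian W for false & Num.conj}).

Let inner_bilinear v w :
  bilinear_for *:%R *:%R (fun v' w' => (f v v' * g w w')^* : C^o).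
Proof.
split=> u c s t /=; rewrite linearPr /= ?mulrDl ?mulrDr rmorphD; congr (_ + _).
  by rewrite -mulrA rmorphM /= conjCK.
by rewrite mulrCA rmorphM /= conjCK.
Qed.

Let outer_bilinear t : bilinear_for *:%R *:%R (fun v w =>
    (tlift (fun v' w' => (f v v' * g w w')^* : C^o) t)^* : C^o).
Proof.
split=> u c v1 v2 /=; elim/tens_ind: t => [|v w t IHt].
- have L v' w' : tlift (fun v w => (f v' v * g w' w)^* : C^o) (0 : tens V W) = 0.
    by have := tlift_linear (inner_bilinear v' w') (-1) 0 0;
       rewrite scaleN1r addNr scaleN1r addNr.
  by rewrite !L rmorph0 scaler0 addr0.
- have L v' w' : tlift (fun v w => (f v' v * g w' w)^* : C^o) (v ⊗ w + t)
      = (f v' v * g w' w)^* + tlift (fun v w => (f v' v * g w' w)^* : C^o) t.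
    have := tlift_linear (inner_bilinear v' w') 1 (v ⊗ w) t.
    by rewrite !scale1r tlift_pure.
  rewrite !L !rmorphD /= IHt !conjCK linearPl /= scalerDr addrACA.
  by congr (_ + _); rewrite mulrDl -mulrA.
- have L v' w' : tlift (fun v w => (f v' v * g w' w)^* : C^o) (0 : tens V W) = 0.
    by have := tlift_linear (inner_bilinear v' w') (-1) 0 0;
       rewrite scaleN1r addNr scaleN1r addNr.
  by rewrite !L rmorph0 scaler0 addr0.
- have L v' w' : tlift (fun v w => (f v' v * g w' w)^* : C^o) (v ⊗ w + t)
      = (f v' v * g w' w)^* + tlift (fun v w => (f v' v * g w' w)^* : C^o) t.
    have := tlift_linear (inner_bilinear v' w') 1 (v ⊗ w) t.
    by rewrite !scale1r tlift_pure.
  rewrite !L !rmorphD /= IHt !conjCK linearPl /= scalerDr addrACA.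
  by congr (_ + _); rewrite mulrDr mulrCA.
Qed.

Lemma tform_pure v w v' w' : tform f g (v ⊗ w) (v' ⊗ w') = f v v' * g w w'.
Proof.
rewrite /tform (tlift_pure (outer_bilinear _)) (tlift_pure (inner_bilinear _ _)).
exact: conjCK.
Qed.

Lemma tform_linearl t : linear ((tform f g)^~ t : tens V W -> C^o).
Proof. exact: tlift_linear. Qed.

End TForm.

(** * The Lie superalgebras gl(m|n) and sl(m|n)

    Both live in the square matrices of size [m + n]; the first [m] indices
    (the epsilons) are even, the last [n] (the deltas) are odd. *)

Section LieSuper.
Variables (R : realType) (m n : nat).
Local Notation C := R[i].
Local Notation mat := 'M[C]_(m + n).

Definition idx_odd (i : 'I_(m + n)) : bool := (m <= i)%N.

(** The component of [X] of parity [b] ([false] is even, [true] is odd). *)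
Definition mxpart (b : bool) (X : mat) : mat :=
  \matrix_(i, j) (if idx_odd i (+) idx_odd j == b then X i j else 0).

Definition mxhomog (b : bool) (X : mat) : Prop := mxpart b X = X.

Definition supertrace (X : mat) : C := \tr (ulsubmx X) - \tr (drsubmx X).

Definition sbracket (X Y : mat) : mat :=
  \sum_(a : bool) \sum_(b : bool)
    (mxpart a X *m mxpart b Y
     - (-1) ^+ (a && b) *: (mxpart b Y *m mxpart a X)).

Definition sl : {pred mat} := [pred X | supertrace X == 0].

(** For [m = n] the weights of sl(n|n) do not separate the roots, and highest
    weight representations are those of gl(n|n): [slhat] is sl(m|n) if
    [m != n] and gl(n|n) if [m = n]. *)
Definition slhat : {pred mat} := [pred X | (m == n) || (supertrace X == 0)].

(** [g] is meant to be a Lie superalgebra of matrices; the values of [rep_act]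
    outside [g] are irrelevant. *)
Record superrep (g : {pred mat}) := SuperRep {
  rep_car :> lmodType C;
  rep_par : bool -> rep_car -> Prop;
  rep_act : mat -> rep_car -> rep_car;
  rep_par0 : forall b, rep_par b 0;
  rep_parP : forall b c v w,
    rep_par b v -> rep_par b w -> rep_par b (c *: v + w);
  rep_parD : forall v, exists v0 v1,
    [/\ rep_par false v0, rep_par true v1 & v = v0 + v1];
  rep_parI : forall v, rep_par false v -> rep_par true v -> v = 0;
  rep_act_linear : forall X, X \in g -> linear (rep_act X);
  rep_act_linearl : forall c X Y v, X \in g -> Y \in g ->
    rep_act (c *: X + Y) v = c *: rep_act X v + rep_act Y v;
  rep_act_par : forall a b X v, X \in g -> mxhomog a X ->
    rep_par b v -> rep_par (a (+) b) (rep_act X v);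
  rep_act_bracket : forall a b X Y v, X \in g -> Y \in g ->
    mxhomog a X -> mxhomog b Y ->
    rep_act (sbracket X Y) v =
      rep_act X (rep_act Y v) - (-1) ^+ (a && b) *: rep_act Y (rep_act X v)
}.

Section Reps.
Variable g : {pred mat}.
Implicit Types V W : superrep g.

Definition subrep V (U : V -> Prop) : Prop :=
  [/\ U 0,
      forall c v w, U v -> U w -> U (c *: v + w),
      forall v0 v1, rep_par false v0 -> rep_par true v1 ->
        U (v0 + v1) -> U v0 /\ U v1
    & forall X v, X \in g -> U v -> U (rep_act X v)].

Definition simple_rep V : Prop :=
  (exists v : V, v != 0) /\
  forall U : V -> Prop, subrep U ->
    (forall v, U v -> v = 0) \/ (forall v, U v).

(** [pos i j] says that the root of the matrix unit [delta_mx i j], namely the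
    difference of the [i]-th and [j]-th coordinate functions, is positive. The
    weight [Lam] is the functional mapping a diagonal matrix [H] to
    [\sum_i Lam 0 i * H i i]. *)
Definition highest_weight_vector (pos : rel 'I_(m + n)) (Lam : 'rV[C]_(m + n))
    V (v : V) : Prop :=
  [/\ v != 0,
      exists b, rep_par b v,
      forall i j, pos i j -> rep_act (delta_mx i j) v = 0
    & forall H, H \in g -> is_diag_mx H ->
        rep_act H v = (\sum_i Lam 0 i * H i i) *: v].

(** [V] is a model of L([Lam]; [pos]). No convention on the parity of the
    highest weight vector is imposed. *)
Definition simple_highest_weight pos Lam V : Prop :=
  simple_rep V /\ exists v : V, highest_weight_vector pos Lam v.

(** [f] need only commute with [a], which may be smaller than [g]. *)
Definition rep_iso (a : {pred mat}) V W (f : {linear V -> W}) : Prop :=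
  [/\ bijective f,
      forall b v, rep_par b v -> rep_par b (f v)
    & forall X v, X \in a -> f (rep_act X v) = rep_act X (f v)].

Section ParityReversal.
Variables (e : bool) (V : superrep g).

Let par b (v : V) := rep_par (b (+) e) v.

Fact Pi_parD v : exists v0 v1, [/\ par false v0, par true v1 & v = v0 + v1].
Proof.
have [v0 [v1 [h0 h1 ->]]] := rep_parD v; rewrite /par; case: e.
  by exists v1, v0; rewrite addrC.
by exists v0, v1.
Qed.

Fact Pi_parI v : par false v -> par true v -> v = 0.
Proof. by rewrite /par; case: e => /= h h'; apply: rep_parI. Qed.

Fact Pi_act_par a b X v : X \in g -> mxhomog a X ->
  par b v -> par (a (+) b) (rep_act X v).
Proof. by rewrite /par -addbA; apply: rep_act_par. Qed.

Definition Pi : superrep g :=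
  @SuperRep g V par (@rep_act g V)
    (fun b => rep_par0 V _) (fun b => @rep_parP g V _) Pi_parD Pi_parI
    (@rep_act_linear g V) (@rep_act_linearl g V) Pi_act_par
    (@rep_act_bracket g V).

End ParityReversal.
End Reps.

Definition pos_st : rel 'I_(m + n) := fun i j =>
  match split i, split j with
  | inl i, inl j => (i < j)%N
  | inr a, inr b => (a < b)%N
  | inl _, inr _ => true
  | inr _, inl _ => false
  end.

Definition pos_nst (p : nat) : rel 'I_(m + n) := fun i j =>
  match split i, split j with
  | inl i, inl j => (i < j)%N
  | inr a, inr b => (a < b)%N
  | inl i, inr _ => (i < p)%N
  | inr _, inl j => (p <= j)%N
  end.

(** * Polarizations, oscillator module and Dirac operator

    All indices start at 0: [k : 'I_(m * n)] stands for the pair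
    [(k %/ n, k %% n)]. *)

Fact osc_row_proof (k : 'I_(m * n)) : (k %/ n < m)%N.
Proof.
have n0 : (0 < n)%N by move: (ltn_ord k); case: (n) k => //; rewrite muln0.
by rewrite ltn_divLR.
Qed.
Fact osc_col_proof (k : 'I_(m * n)) : (k %% n < n)%N.
Proof.
have n0 : (0 < n)%N by move: (ltn_ord k); case: (n) k => //; rewrite muln0.
by rewrite ltn_pmod.
Qed.

Definition osc_row (k : 'I_(m * n)) : 'I_(m + n) :=
  lshift n (Ordinal (osc_row_proof k)).
Definition osc_col (k : 'I_(m * n)) : 'I_(m + n) :=
  rshift m (Ordinal (osc_col_proof k)).

Record polarization := Polarization {
  pol_d : 'I_(m * n) -> mat;
  pol_x : 'I_(m * n) -> mat
}.

Definition d_st (k : 'I_(m * n)) : mat := delta_mx (osc_row k) (osc_col k).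
Definition x_st (k : 'I_(m * n)) : mat := delta_mx (osc_col k) (osc_row k).

Definition pol_st : polarization := Polarization d_st x_st.

Definition pol_nst (p : nat) : polarization := Polarization
  (fun k => if (k < p * n)%N then d_st k else x_st k)
  (fun k => if (k < p * n)%N then x_st k else - d_st k).

Definition oscillator := {mpoly C[m * n]}.
HB.instance Definition _ := GRing.Lmodule.on oscillator.

Definition vacuum : oscillator := 1%:MP.

Definition osc_form (P Q : oscillator) : C :=
  \sum_(a <- msupp P) P@_a * (Q@_a)^* * (\prod_(k < m * n) (a k)`!)%:R.

Lemma osc_formE d (P Q : oscillator) : (msize P <= d)%N ->
  osc_form P Q =
  \sum_(a : 'X_{1..(m * n) < d}) P@_a * (Q@_a)^* * (\prod_(k < m * n) (a k)`!)%:R.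
Proof.
move=> hd; rewrite /osc_form (big_mksub 'X_{1..(m * n) < d}) /=; first last.
- by move=> a /msize_mdeg_lt /leq_trans; apply.
- exact: msupp_uniq.
rewrite big_rmcond // => a /memN_msupp_eq0 ->; by rewrite !mul0r.
Qed.

Fact osc_form_bilinear :
  bilinear_for *%R (Num.conj \; *%R : C -> C -> C) osc_form.
Proof.
split=> [Q c P P'|P c Q Q'] /=.
  pose d := maxn (maxn (msize P) (msize P')) (msize (c *: P + P')).
  have [h1 h2 h3] : [/\ msize P <= d, msize P' <= d & msize (c *: P + P') <= d]%N.
    by rewrite !leq_max !leqnn !orbT.
  rewrite !(@osc_formE d) // mulr_sumr -big_split /=; apply: eq_bigr => a _.
  by rewrite mcoeffD mcoeffZ !mulrDl !mulrA.
rewrite /osc_form mulr_sumr -big_split /=; apply: eq_bigr => a _.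
by rewrite mcoeffD mcoeffZ rmorphD rmorphM /= mulrDr mulrDl mulrCA !mulrA.
Qed.

Fact osc_form_hermitian (P Q : oscillator) :
  osc_form P Q = (-1) ^+ false * (osc_form Q P)^*.
Proof.
pose d := maxn (msize P) (msize Q).
rewrite expr0 mul1r !(@osc_formE d) ?leq_max ?leqnn ?orbT // rmorph_sum /=.
apply: eq_bigr => a _; rewrite !rmorphM /= conjCK rmorph_nat.
by rewrite [(P@_a) * _]mulrC.
Qed.

HB.instance Definition _ := bilinear_isBilinear.Build C oscillator oscillator C
  *%R (Num.conj \; *%R) osc_form osc_form_bilinear.
HB.instance Definition _ :=
  isHermitianSesquilinear.Build C oscillator false Num.conj osc_form
    osc_form_hermitian.

Lemma osc_form_monomials (a b : 'X_{1..(m * n)}) :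
  osc_form ('X_[a] : {mpoly C[m * n]}) ('X_[b] : {mpoly C[m * n]})
  = if a == b then (\prod_(k < m * n) (a k)`!)%:R else 0.
Proof.
rewrite /osc_form msuppX big_seq1 !mcoeffX eqxx mul1r eq_sym.
by case: eqP => _; rewrite ?rmorph1 ?mul1r // rmorph0 mul0r.
Qed.

(** An element [a ⊗ b] of U(g) ⊗ W(g_1) acts on [V ⊗ oscillator] by [tmap a b],
    without signs; the generators of the Weyl algebra act by multiplication by
    a variable and by partial derivation. *)
Definition osc_mul (k : 'I_(m * n)) (P : oscillator) : oscillator :=
  ('X_k : {mpoly C[m * n]}) * (P : {mpoly C[m * n]}).
Definition osc_deriv (k : 'I_(m * n)) (P : oscillator) : oscillator :=
  mderiv k P.

Definition Dirac (pol : polarization) (g : {pred mat}) (V : superrep g)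
    (u : tens V oscillator) : tens V oscillator :=
  2 *: \sum_(k < m * n)
    (tmap (rep_act (pol_d pol k)) (osc_mul k) u
     - tmap (rep_act (pol_x pol k)) (osc_deriv k) u).

Definition correction (p : nat) (g : {pred mat}) (V : superrep g)
    (u : tens V oscillator) : tens V oscillator :=
  4 *: \sum_(k < m * n | (p * n <= k)%N)
    tmap (rep_act (sbracket (d_st k) (x_st k))) id u.

End LieSuper.

Arguments sl R m n : clear implicits.
Arguments slhat R m n : clear implicits.
Arguments pos_st m n : clear implicits.
Arguments pos_nst m n p : clear implicits.
Arguments pol_st R m n : clear implicits.
Arguments pol_nst R m n p : clear implicits.
Arguments vacuum R m n : clear implicits.
Arguments osc_form {R m n}.
Arguments Dirac {R m n} pol {g} V u.
Arguments correction {R m n} p {g} V u.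

Section Unitarity.
Variables (R : realType) (p q n : nat).
Local Notation C := R[i].

Definition sigJ : 'M[C]_(p + q + n) :=
  diag_mx (row_mx (row_mx (const_mx 1) (const_mx (-1))) (const_mx (-1))).

Definition omega (X : 'M[C]_(p + q + n)) : 'M[C]_(p + q + n) :=
  invmx sigJ *m (map_mx Num.conj X)^T *m sigJ.

Definition contravariant (g : {pred 'M[C]_(p + q + n)})
    (V : superrep g) (f : V -> V -> C) : Prop :=
  forall X v w, X \in sl R (p + q) n ->
    f (rep_act X v) w = f v (rep_act (omega X) w).

(** Contravariance is only required for sl(p + q|n), also when [g] is larger. *)
Definition unitary (g : {pred 'M[C]_(p + q + n)}) (V : superrep g) : Prop :=
  exists f : {dot V for Num.conj},
    contravariant f /\
    forall v w, rep_par false v -> rep_par true w -> f v w = 0.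

End Unitarity.

(* Main.v *)
(* Since the vacuum is annihilated by every derivation and orthogonal to every
   polynomial without constant term, pairing D^2(u ⊗ 1) with u ⊗ 1 leaves only
   -4 \sum_k <x_k d_k u, u>. For [k >= p * n] the two polarizations replace
   [x_k d_k] by [- d_k x_k], and the difference is the odd bracket
   [[d_k, x_k] = d_k x_k + x_k d_k]. *)
From HB Require Import structures.
Require Import Defs.
From mathcomp Require Import all_boot all_order all_algebra.
From mathcomp Require Import sesquilinear reals complex mpoly.
Local Open Scope ring_scope.
Import Order.TTheory GRing.Theory Num.Theory.

(** Bundles a bare function with its linearity proof, so that [linearZ] and [linear_sum] apply to
    [Dirac] or to a form with fixed second argument. *)
Definition linear_of {F : fieldType} {U V : lmodType F} {f : U -> V}
    (hf : linear f) : {linear U -> V} :=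
  HB.pack f (GRing.isLinear.Build F U V *:%R f hf).

(** * Action of opposites and of odd brackets *)

Section Representations.
Context {R : realType} {m n : nat} {g : {pred 'M[R[i]]_(m + n)}}.
Implicit Types (V : superrep g) (X Y : 'M[R[i]]_(m + n)).

Lemma rep_act0 V X (v : V) : X \in g -> rep_act 0 v = 0.
Proof.
move=> gX; have := rep_act_linearl (-1) v gX gX.
by rewrite !scaleN1r !addNr.
Qed.

(** Linearity in the matrix is granted only inside [g], an arbitrary predicate; hence the membership
    of [0], which serves as the second summand. *)
Lemma rep_actN V X (v : V) :
  X \in g -> 0 \in g -> rep_act (- X) v = - rep_act X v.
Proof.
move=> gX g0; have := rep_act_linearl (-1) v gX g0.
by rewrite (rep_act0 V X v gX) !addr0 !scaleN1r.
Qed.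

Lemma rep_act_sbracket_odd V X Y (v : V) :
  X \in g -> Y \in g -> mxhomog true X -> mxhomog true Y ->
  rep_act (sbracket X Y) v = rep_act X (rep_act Y v) + rep_act Y (rep_act X v).
Proof.
move=> gX gY hX hY; rewrite (rep_act_bracket v gX gY hX hY) /=.
by rewrite expr1 scaleN1r opprK.
Qed.

End Representations.

(** * Membership and parity of the odd matrix units *)

Section MatrixUnits.
Context {R : realType} {m n : nat}.
Implicit Type X : 'M[R[i]]_(m + n).

Lemma sl_slhat X : X \in sl R m n -> X \in slhat R m n.
Proof. by rewrite !inE orbC => ->. Qed.

Lemma sl_diag0 X : (forall i, X i i = 0) -> X \in sl R m n.
Proof.
move=> X0; rewrite inE /supertrace /mxtrace !big1 ?subrr // => i _;
by rewrite !mxE X0.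
Qed.

Lemma d_st_diag (k : 'I_(m * n)) i : d_st R k i i = 0.
Proof. by rewrite mxE; case: eqP => // ->; rewrite eq_lrshift. Qed.

Lemma x_st_diag (k : 'I_(m * n)) i : x_st R k i i = 0.
Proof. by rewrite mxE; case: eqP => // ->; rewrite eq_rlshift. Qed.

Lemma d_st_sl (k : 'I_(m * n)) : d_st R k \in sl R m n.
Proof. by apply: sl_diag0 => i; rewrite d_st_diag. Qed.

Lemma d_st_opp_sl (k : 'I_(m * n)) : - d_st R k \in sl R m n.
Proof. by apply: sl_diag0 => i; rewrite mxE d_st_diag oppr0. Qed.

Lemma x_st_sl (k : 'I_(m * n)) : x_st R k \in sl R m n.
Proof. by apply: sl_diag0 => i; rewrite x_st_diag. Qed.

(** Truncating to a parity changes only entries of the other parity, and there a matrix unit is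
    already zero. *)
Lemma mxhomog_delta (i j : 'I_(m + n)) :
  mxhomog (idx_odd i (+) idx_odd j) (delta_mx i j : 'M[R[i]]_(m + n)).
Proof.
apply/matrixP => a b; rewrite !mxE; case: (altP andP) => [[/eqP-> /eqP->]|_].
  by rewrite eqxx.
by case: ifP.
Qed.

Lemma idx_odd_osc_row (k : 'I_(m * n)) : idx_odd (osc_row k) = false.
Proof. by apply/negbTE; rewrite -ltnNge osc_row_proof. Qed.

Lemma idx_odd_osc_col (k : 'I_(m * n)) : idx_odd (osc_col k) = true.
Proof. exact: leq_addr. Qed.

Lemma d_st_odd (k : 'I_(m * n)) : mxhomog true (d_st R k).
Proof.
by have := mxhomog_delta (osc_row k) (osc_col k);
   rewrite idx_odd_osc_row idx_odd_osc_col.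
Qed.

Lemma x_st_odd (k : 'I_(m * n)) : mxhomog true (x_st R k).
Proof.
by have := mxhomog_delta (osc_col k) (osc_row k);
   rewrite idx_odd_osc_row idx_odd_osc_col.
Qed.

End MatrixUnits.

(** * Pairings with the vacuum in the oscillator module *)

Section Oscillator.
Context {R : realType} {m n : nat}.
Local Notation osc := (oscillator R m n).
Local Notation vac := (vacuum R m n).

Lemma osc_mul_linear (k : 'I_(m * n)) : linear (osc_mul k : osc -> osc).
Proof. by move=> c P Q; rewrite /osc_mul mulrDr scalerAr. Qed.

Lemma osc_deriv_linear (k : 'I_(m * n)) : linear (osc_deriv k : osc -> osc).
Proof. exact: mderiv_is_linear. Qed.

Lemma osc_mul_vacuum (k : 'I_(m * n)) :
  osc_mul k vac = 'X_k :> {mpoly R[i][m * n]}.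
Proof. exact: mulr1. Qed.

Lemma osc_deriv_vacuum (k : 'I_(m * n)) : osc_deriv k vac = 0.
Proof. exact: mderivC. Qed.

Lemma vacuum_monomial : vac = 'X_[0%MM] :> {mpoly R[i][m * n]}.
Proof. by rewrite mpolyX0. Qed.

Lemma osc_form_vacuum : osc_form vac vac = 1.
Proof.
by rewrite vacuum_monomial osc_form_monomials eqxx big1 // => k _; rewrite mnm0E.
Qed.

Lemma osc_form_mul_var (k l : 'I_(m * n)) :
  osc_form (osc_mul k (osc_mul l vac)) vac = 0.
Proof.
rewrite osc_mul_vacuum /osc_mul -mpolyXD vacuum_monomial osc_form_monomials.
(* The exponent of the product is positive at [k], so it is not that of the vacuum. *)
case: eqP => // /mnmP/(_ k).
by rewrite mnmDE mnm1E eqxx mnm0E.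
Qed.

Lemma osc_form_deriv_var (k l : 'I_(m * n)) :
  osc_form (osc_deriv k (osc_mul l vac)) vac = (k == l)%:R.
Proof.
have -> : osc_deriv k (osc_mul l vac) = (l == k)%:R *: vac :> osc.
  rewrite osc_mul_vacuum /osc_deriv mderivX mnm1E.
  (* For [l] distinct from [k] the coefficient is zero, so the truncated difference of exponents is
     harmless. *)
  case: eqP => [->|_]; last by rewrite !scale0r.
  suff -> : (U_(k) - U_(k))%MM = 0%MM :> 'X_{1..(m * n)} by rewrite vacuum_monomial.
  by apply/mnmP => i; rewrite mnmBE subnn mnm0E.
by rewrite linearZl_LR /= osc_form_vacuum mulr1 eq_sym.
Qed.

End Oscillator.

(** * The square of the Dirac operator on the vacuum *)

Section DiracSquare.
Context {R : realType} {m n : nat} {g : {pred 'M[R[i]]_(m + n)}}.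
Variables (pol : polarization R m n) (V : superrep g).
Hypothesis pol_dg : forall k, pol_d pol k \in g.
Hypothesis pol_xg : forall k, pol_x pol k \in g.
Local Notation d k := (rep_act (pol_d pol k)).
Local Notation x k := (rep_act (pol_x pol k)).
Local Notation vac := (vacuum R m n).

Lemma Dirac_linear : linear (Dirac pol V).
Proof.
move=> c s t; rewrite /Dirac scalerA mulrC -scalerA -scalerDr.
congr (_ *: _); rewrite scaler_sumr -big_split; apply: eq_bigr => k _ /=.
have dX := tmap_linear (rep_act_linear (s := V) (pol_dg k)) (osc_mul_linear k).
have xD := tmap_linear (rep_act_linear (s := V) (pol_xg k)) (osc_deriv_linear k).
by rewrite dX xD scalerBr opprD addrACA.
Qed.

Lemma Dirac_pure (v : V) P :
  Dirac pol V (v ⊗ P) =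
  2 *: \sum_k (d k v ⊗ osc_mul k P - x k v ⊗ osc_deriv k P).
Proof.
congr (_ *: _); apply: eq_bigr => k _.
rewrite tmap_pure; [|exact: rep_act_linear|exact: osc_mul_linear].
by rewrite tmap_pure; [|exact: rep_act_linear|exact: osc_deriv_linear].
Qed.

Lemma Dirac_vacuum (v : V) :
  Dirac pol V (v ⊗ vac) = 2 *: \sum_k d k v ⊗ osc_mul k vac.
Proof.
rewrite Dirac_pure; congr (_ *: _); apply: eq_bigr => k _.
by rewrite osc_deriv_vacuum -(scale0r 0) tpure_scaler scale0r subr0.
Qed.

(** The first [Dirac] creates one variable, and only the derivation by that same variable leads back
    to the vacuum. The two factors 2 and the sign of the derivation term give -4. The polarization
    stays general so that both cases are instances. *)
Lemma form_Dirac_sqr_vacuum (f : {hermitian V for false & Num.conj}) (v : V) :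
  tform f osc_form (Dirac pol V (Dirac pol V (v ⊗ vac))) (v ⊗ vac) =
  - 4 * \sum_k f (x k (d k v)) v.
Proof.
pose T (s : tens V (oscillator R m n)) : R[i] := tform f osc_form s (v ⊗ vac).
pose T' := linear_of (tform_linearl f osc_form (v ⊗ vac)).
have Tsum c F : T (c *: \sum_(k < m * n) F k) = c * \sum_(k < m * n) T (F k).
  by rewrite -[LHS]/(T' _) linearZ linear_sum.
have TE a P b Q : T (a ⊗ P - b ⊗ Q) =
    f a v * osc_form P vac - f b v * osc_form Q vac.
  by rewrite -[LHS]/(T' _) linearB /= !tform_pure.
have TD k : T (Dirac pol V (d k v ⊗ osc_mul k vac)) = - 2 * f (x k (d k v)) v.
  (* Among the terms of the second [Dirac], only the derivation with index [k] pairs nontrivially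
     with the vacuum. *)
  rewrite Dirac_pure Tsum (bigD1 k) // big1 => [|l lk].
    rewrite TE osc_form_mul_var osc_form_deriv_var eqxx.
    by rewrite mulr0 mulr1 sub0r /= addr0 mulrN mulNr.
  rewrite TE osc_form_mul_var osc_form_deriv_var.
  by rewrite (negbTE lk) !mulr0 subrr.
pose D := linear_of Dirac_linear.
rewrite -[LHS]/(T (D _)) Dirac_vacuum linearZ linear_sum Tsum !mulr_sumr.
by apply: eq_bigr => k _; rewrite [T _]TD mulrA mulrN -natrM.
Qed.

End DiracSquare.

(** * The correction term and the comparison of polarizations *)

Lemma form_correction (R : realType) (m n p : nat)
    (V : superrep (slhat R m n)) (f : {hermitian V for false & Num.conj})
    (v : V) :
  tform f osc_form (correction p V (v ⊗ vacuum R m n)) (v ⊗ vacuum R m n) =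
  4 * \sum_(k < m * n | (p * n <= k)%N)
        (f (rep_act (d_st R k) (rep_act (x_st R k) v)) v
         + f (rep_act (x_st R k) (rep_act (d_st R k) v)) v).
Proof.
pose T := linear_of (tform_linearl f osc_form (v ⊗ vacuum R m n)).
rewrite -[LHS]/(T _) /correction linearZ linear_sum; congr (_ * _).
apply: eq_bigr => k _.
have dG : d_st R k \in slhat R m n by apply/sl_slhat/d_st_sl.
have xG : x_st R k \in slhat R m n by apply/sl_slhat/x_st_sl.
have dxE (w : V) : rep_act (sbracket (d_st R k) (x_st R k)) w =
    rep_act (d_st R k) (rep_act (x_st R k) w)
    + rep_act (x_st R k) (rep_act (d_st R k) w).
  by apply: rep_act_sbracket_odd => //; [exact: d_st_odd | exact: x_st_odd].
(* Linearity is read off from the expansion [dxE], which avoids proving that the bracket lies in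
   [slhat]. *)
have dx_linear : linear (rep_act (s := V) (sbracket (d_st R k) (x_st R k))).
  move=> c w w'; rewrite !dxE !(rep_act_linear (s := V) xG).
  rewrite !(rep_act_linear (s := V) dG) !(rep_act_linear (s := V) xG).
  by rewrite scalerDr addrACA.
rewrite tmap_pure // -[LHS]/(tform f osc_form _ _) tform_pure /=.
by rewrite osc_form_vacuum mulr1 dxE linearDl.
Qed.

Theorem lemma44 (R : realType) (p q n : nat)
    (hp : (1 <= p)%N) (hq : (1 <= q)%N) (hn : (1 <= n)%N)
    (Lam Lam' : 'rV[R[i]]_(p + q + n))
    (V W : superrep (slhat R (p + q) n))
    (hV : simple_highest_weight (pos_st (p + q) n) Lam V)
    (hVu : unitary V)
    (hW : simple_highest_weight (pos_nst (p + q) n p) Lam' W)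
    (e : bool)
    (hLam' : exists psi : {linear V -> Pi e W}, rep_iso (slhat R (p + q) n) psi)
    (formV : {hermitian V for false & Num.conj})
    (formW : {hermitian (Pi e W) for false & Num.conj})
    (hformV : contravariant formV) (hformV0 : exists v w : V, formV v w != 0)
    (hformW : contravariant formW) (hformW0 : exists v w : Pi e W, formW v w != 0)
    (phi : {linear V -> Pi e W})
    (hphi : rep_iso (sl R (p + q) n) phi)
    (hiso : forall v w : V, formW (phi v) (phi w) = formV v w)
    (v : V) :
  let D_st := Dirac (pol_st R (p + q) n) V in
  let D_nst := Dirac (pol_nst R (p + q) n p) (Pi e W) in
  let C := correction p V in
  let v_st := v ⊗ vacuum R (p + q) n in
  let v_nst := phi v ⊗ vacuum R (p + q) n in
  tform formW osc_form (D_nst (D_nst v_nst)) v_nst =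
  tform formV osc_form (D_st (D_st v_st) + C v_st) v_st.
Proof.
move=> D_st D_nst C v_st v_nst.
have dG k : d_st R k \in slhat R (p + q) n by apply/sl_slhat/d_st_sl.
have xG k : x_st R k \in slhat R (p + q) n by apply/sl_slhat/x_st_sl.
have G0 : 0 \in slhat R (p + q) n by apply/sl_slhat/sl_diag0 => i; rewrite mxE.
have NdG k : - d_st R k \in slhat R (p + q) n by apply/sl_slhat/d_st_opp_sl.
(* [Pi e W] has the action of [W]; [phi] intertwines only over [sl], so membership in [slhat] would
   not suffice here. *)
have phiE X u : X \in sl R (p + q) n ->
    rep_act (s := W) X (phi u) = phi (rep_act X u).
  by move=> slX; case: hphi => _ _ ->.
pose T := linear_of (tform_linearl formV osc_form v_st).
have -> : tform formV osc_form (D_st (D_st v_st) + C v_st) v_st =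
    T (D_st (D_st v_st)) + T (C v_st) by rewrite -linearD.
rewrite [T (C _)]form_correction [T _]form_Dirac_sqr_vacuum //.
rewrite form_Dirac_sqr_vacuum => [|k|k] /=; try by case: ifP.
(* Padding the correction with zeros below [p * n] makes all sums range over the same [k], so it
   suffices to compare terms. *)
rewrite [X in _ = _ + 4 * X]big_mkcond /= !mulNr !mulr_sumr -!sumrN -big_split.
apply: eq_bigr => k _ /=.
(* Below [p * n] the polarizations agree and [phi] transports the term. *)
case: ltnP => _; first by rewrite !phiE ?hiso ?mulr0 ?addr0 ?d_st_sl ?x_st_sl.
(* From [p * n] on, the sign in [- d_st k] turns the left term into +4 times the pairing of [d x v]
   with [v]; on the right the [x d] part of the bracket cancels the Dirac term and leaves the
   same. *)
rewrite rep_actN // linearNl !phiE ?d_st_sl ?x_st_sl //.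
rewrite mulrN opprK mulrDr [RHS]addrC addrK; congr (_ * _); apply: hiso.
Qed.
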